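(* Let $H=(V,E)$ be a connected finite hypergraph with vertex measure $\mu$ and hyperedge weight $\omega$, and let $\Omega$ be a non-empty finite subset of $V$ such that $\Omega^c=V\setminus\Omega$ is non-empty. Then for any function $f:\Omega\to\mathbb{R}$, the Dirichlet problem $$\begin{cases}-\Delta\phi=f & \text{in }\Omega,\\ \phi=0 & \text{on }\partial\Omega\end{cases}$$ has a unique solution.
   Context: A (finite, undirected) hypergraph $H=(V,E)$ consists of a finite vertex set $V$ and a set $E$ of hyperedges, each hyperedge $e\in E$ being a subset of $V$ with cardinality $\delta_e:=|e|$ satisfying $2\le\delta_e\le|V|$. $H$ is connected if for any two different vertices $v,v'$ there is a sequence of hyperedges $e_1,\dots,e_l\in E$ with $v\in e_1$, $v'\in e_l$ and $e_n\cap e_{n+1}\ne\emptyset$ for $1\le n\le l-1$. The measure is a function $\mu:V\to(0,\infty)$ and the weight is a function $\omega:E\to(0,\infty)$, written $\omega_e=\omega(e)$. The Laplace operator (divergence of the hypergraph gradient) of $\phi:V\to\mathbb{R}$ is given explicitly by $$\Delta\phi(v)=\frac{1}{\mu(v)}\sum_{e\in E:\,v\in e}\frac{\omega_e}{\delta_e-1}\sum_{u\in e:\,u\ne v}(\phi(u)-\phi(v)),\quad v\in V.$$ The boundary of $\Omega$ is $\partial\Omega=\{u\in V\setminus\Omega:\ \exists\, v\in\Omega,\ \exists\, e\in E\text{ with }u,v\in e\}$. Convention: a function satisfying $\phi=0$ on $\partial\Omega$ is understood to be $0$ on all of $\Omega^c$. Thus a solution is a function $\phi:V\to\mathbb{R}$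 with $\phi=0$ on $\Omega^c$ and $-\Delta\phi(v)=f(v)$ for every $v\in\Omega$. *)

(* Defs.v *)
From HB Require Import structures.
From mathcomp Require Import all_boot all_order all_algebra.
From mathcomp Require Import reals.
Set Implicit Arguments.
Unset Strict Implicit.
Unset Printing Implicit Defensive.
Import Order.TTheory GRing.Theory Num.Theory.
Local Open Scope ring_scope.

Record hypergraph (V : finType) := Hypergraph {
  hyperedges :> {set {set V}};
  hyperedge_card : forall e, e \in hyperedges -> (2 <= #|e| <= #|V|)%N
}.

(* The sequence e_1, ..., e_l (with l >= 1) is e :: s. *)
Definition hconnected (V : finType) (H : hypergraph V) : Prop :=
  forall v v' : V, v != v' ->
    exists (e : {set V}) (s : seq {set V}),
      [/\ {subset e :: s <= hyperedges H},
          v \in e,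
          v' \in last e s
        & path (fun e1 e2 : {set V} => e1 :&: e2 != set0) e s].

(* The weight omega is total on {set V}; only its values on the hyperedges of H
   are used. *)
Definition laplacian (R : realType) (V : finType) (H : hypergraph V)
    (mu : V -> R) (omega : {set V} -> R) (phi : V -> R) (v : V) : R :=
  (mu v)^-1 *
    \sum_(e in hyperedges H | v \in e)
      omega e / (#|e|%:R - 1) * \sum_(u in e | u != v) (phi u - phi v).

(* By convention, the condition "phi = 0 on the boundary of Omega" means that
   phi vanishes on the whole complement of Omega, not only on the vertices of
   the complement that share a hyperedge with a vertex of Omega. *)
Definition dirichlet_solution (R : realType) (V : finType) (H : hypergraph V)
    (mu : V -> R) (omega : {set V} -> R) (Omega : {set V})
    (f : {v : V | v \in Omega} -> R) (phi : V -> R) : Prop :=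
  (forall v : {v : V | v \in Omega},
     - laplacian H mu omega phi (val v) = f v) /\
  (forall v : V, v \in ~: Omega -> phi v = 0).

(* Main.v *)
Require Import Defs.
From HB Require Import structures.
From mathcomp Require Import all_boot all_order all_algebra.
From mathcomp Require Import boolp reals.
Import Order.TTheory GRing.Theory Num.Theory.
Local Open Scope ring_scope.

(** The Dirichlet problem is a square linear system: the map that sends [phi]
    to [- laplacian phi] on [Omega] and to [phi] off [Omega] is an endomorphism
    of the finite-dimensional space of functions on [V], and a solution is a
    preimage of [f] extended by zero.  Existence and uniqueness both follow once
    this endomorphism is injective ([dirichlet_operator_ker0]).

    Injectivity is the weak maximum principle ([maximum_principle]), applied to
    an element of the kernel and to its opposite.  At a maximum of [phi] every
    term [phi u - phi v] of the Laplacian is nonpositive, so if the Laplacian is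
    nonnegative there, all of them vanish: the maximum spreads to each hyperedge
    through that vertex ([laplacian_ge0_max]).  Were the maximum attained only
    inside [Omega], it would spread along chains of hyperedges to all of [V] by
    connectedness ([hconnected_closed]), including the non-empty complement of
    [Omega]; so it is attained off [Omega], where [phi <= 0]. *)

Section Dirichlet.
Variables (R : realType) (V : finType) (H : hypergraph V).

(** Two consecutive hyperedges of a chain meet, so once one lies in [S] the next
    one contains a vertex of [S]. *)
Lemma hconnected_closed (S : {set V}) (v : V) :
    hconnected H -> v \in S ->
    (forall e w, e \in hyperedges H -> w \in e -> w \in S -> e \subset S) ->
  S = setT.
Proof.
move=> Hconn vS closedS; apply/setP => w; rewrite inE.
have [<- // | neq_vw] := eqVneq v w.
have [e [s [sub_es ve we chain]]] := Hconn _ _ neq_vw.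
have eS : e \subset S by apply: closedS ve vS; apply: sub_es; rewrite mem_head.
suff: last e s \subset S by move/subsetP; apply.
elim: s e eS sub_es chain {ve we} => [//|e' s IHs] e eS sub_es /=.
case/andP=> /set0Pn[x /setIP[xe xe']] chain; apply: IHs chain.
- apply: closedS xe' (subsetP eS _ xe).
  by apply: sub_es; rewrite inE mem_head orbT.
- by move=> e2 e2s; apply: sub_es; rewrite inE e2s orbT.
Qed.

Variables (mu : V -> R) (omega : {set V} -> R).
Hypothesis mu_gt0 : forall v, 0 < mu v.
Hypothesis omega_gt0 : forall e, e \in hyperedges H -> 0 < omega e.

Lemma edge_coef_gt0 (e : {set V}) :
  e \in hyperedges H -> 0 < omega e / (#|e|%:R - 1).
Proof.
move=> eH; apply: divr_gt0; first exact: omega_gt0.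
by rewrite subr_gt0 ltr1n; case/andP: (hyperedge_card eH).
Qed.

(** Strong maximum principle at one vertex: the Laplacian there is a sum of
    nonpositive terms with positive weights, hence can only be nonnegative if
    every term is zero. *)
Lemma laplacian_ge0_max (phi : V -> R) (v : V) :
    (forall u, phi u <= phi v) -> 0 <= laplacian H mu omega phi v ->
  forall e u, e \in hyperedges H -> v \in e -> u \in e -> phi u = phi v.
Proof.
move=> max_v; rewrite /laplacian pmulr_rge0 ?invr_gt0 // => lap_ge0 e u eH ve ue.
have inner_le0 e' : \sum_(w in e' | w != v) (phi w - phi v) <= 0.
  by apply: sumr_le0 => w _; rewrite subr_le0.
set F := fun e' : {set V} => omega e' / (#|e'|%:R - 1) *
           \sum_(w in e' | w != v) (phi w - phi v).
have F_le0 e' : (e' \in hyperedges H) && (v \in e') -> F e' <= 0.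
  by case/andP=> e'H _; rewrite /F pmulr_rle0 ?edge_coef_gt0.
have sumN0 : \sum_(e' in hyperedges H | v \in e') - F e' == 0.
  rewrite sumrN oppr_eq0 eq_le lap_ge0 andbT.
  by apply: sumr_le0 => e' /F_le0.
have Fe0 : F e == 0.
  rewrite psumr_eq0 in sumN0; last by move=> e' /F_le0; rewrite oppr_ge0.
  have /implyP := allP sumN0 e (mem_index_enum _).
  by rewrite eH ve oppr_eq0; apply.
have [-> // | neq_uv] := eqVneq u v.
move: Fe0; rewrite /F mulf_eq0 gt_eqF ?edge_coef_gt0 //= => inner0.
have sumN0' : \sum_(w in e | w != v) - (phi w - phi v) == 0.
  by rewrite sumrN oppr_eq0.
rewrite psumr_eq0 in sumN0'; last by move=> w _; rewrite oppr_ge0 subr_le0.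
have /implyP := allP sumN0' u (mem_index_enum _).
by rewrite ue neq_uv oppr_eq0 subr_eq0 => /(_ isT) /eqP.
Qed.

Lemma maximum_principle (Omega : {set V}) (phi : V -> R) :
    hconnected H -> ~: Omega != set0 ->
    (forall v, v \in Omega -> 0 <= laplacian H mu omega phi v) ->
    (forall v, v \notin Omega -> phi v <= 0) ->
  forall v, phi v <= 0.
Proof.
move=> Hconn /set0Pn[b]; rewrite inE => bO lap_ge0 phi_le0 v.
case: (@arg_maxP _ _ _ v predT phi isT) => m _ max_m.
apply: le_trans (max_m v isT) _.
pose S := [set w | phi w == phi m].
(* Either the maximum is attained at a vertex off [Omega], or the whole set [S]
   of maximizers lies in [Omega]. *)
have [SO | /subsetPn[w]] := boolP (S \subset Omega); last first.
  by rewrite inE => /eqP <- /phi_le0.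
(* In the second case [S] is closed under hyperedges, so it contains [b]. *)
suff ST : S = setT by have := subsetP SO b; rewrite ST inE (negPf bO) => /(_ isT).
apply: (@hconnected_closed S m Hconn); first by rewrite inE.
move=> e w eH we wS; apply/subsetP => u ue.
have /eqP phi_w : phi w == phi m by rewrite inE in wS.
rewrite inE -phi_w; apply/eqP.
apply: (@laplacian_ge0_max phi w _ _ e) => //.
- by move=> x; rewrite phi_w; apply: max_m.
- exact/lap_ge0/(subsetP SO).
Qed.

Lemma laplacian_linear (a : R) (phi psi : V -> R) (v : V) :
  laplacian H mu omega (fun w => a * phi w + psi w) v =
  a * laplacian H mu omega phi v + laplacian H mu omega psi v.
Proof.
rewrite /laplacian mulrCA -mulrDr; congr (_ * _).
rewrite mulr_sumr -big_split /=; apply: eq_bigr => e _.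
rewrite mulrCA -mulrDr; congr (_ * _).
rewrite mulr_sumr -big_split /=; apply: eq_bigr => u _.
by rewrite mulrBr opprD addrACA.
Qed.

Variable Omega : {set V}.

(** The equations [phi v = 0] off [Omega] are kept as rows of the system, which
    makes it square.  The values lie in the regular module [R^o] so that the
    function space is a vector space over [R]. *)
Definition dirichlet_operator (phi : {ffun V -> R^o}) : {ffun V -> R^o} :=
  [ffun v => if v \in Omega then - laplacian H mu omega phi v else phi v].

Fact dirichlet_operator_linear : linear dirichlet_operator.
Proof.
move=> a phi psi; apply/ffunP => v; rewrite !ffunE; case: ifP => _ //.
have -> : (a *: phi + psi : {ffun V -> R^o}) = (fun w => a * phi w + psi w)
            :> (V -> R).
  by apply/funext => w; rewrite !ffunE.
by rewrite laplacian_linear opprD -mulrN.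
Qed.

HB.instance Definition _ :=
  GRing.isLinear.Build R {ffun V -> R^o} {ffun V -> R^o} _ dirichlet_operator
    dirichlet_operator_linear.

Hypothesis Hconn : hconnected H.
Hypothesis OmegaC_neq0 : ~: Omega != set0.

Lemma dirichlet_operator_le0 (phi : {ffun V -> R^o}) :
  dirichlet_operator phi = 0 -> forall v, phi v <= 0.
Proof.
move=> Dphi; apply: (@maximum_principle Omega) => // v.
- move=> vO; move/ffunP/(_ v)/eqP: Dphi.
  by rewrite !ffunE vO oppr_eq0 => /eqP ->.
- by move/negPf=> vO; move/ffunP/(_ v): Dphi; rewrite !ffunE vO => ->.
Qed.

Lemma dirichlet_operator_ker0 (phi : {ffun V -> R^o}) :
  dirichlet_operator phi = 0 -> phi = 0.
Proof.
move=> Dphi; apply/ffunP => v; rewrite [RHS]ffunE; apply/eqP.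
rewrite eq_le dirichlet_operator_le0 //=.
have := @dirichlet_operator_le0 (- phi) _ v.
by rewrite linearN /= Dphi oppr0 ffunE oppr_le0; apply.
Qed.

(** An injective endomorphism of a finite-dimensional space is surjective; this
    is where existence comes from. *)
Lemma dirichlet_operator_bij : bijective dirichlet_operator.
Proof.
have ker0 : lker (linfun dirichlet_operator) == 0%VS.
  apply/lker0P => phi psi; rewrite !lfunE /= => Deq; apply/eqP.
  rewrite -subr_eq0; apply/eqP/dirichlet_operator_ker0.
  by rewrite linearB /= Deq subrr.
exists (linfun dirichlet_operator)^-1%VF => phi.
- by have := lker0_lfunK ker0 phi; rewrite lfunE.
- by have := lker0_lfunVK ker0 phi; rewrite lfunE.
Qed.

Lemma dirichlet_solutionP (f : {v : V | v \in Omega} -> R) (phi : V -> R) :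
  dirichlet_solution H mu omega f phi <->
  dirichlet_operator (finfun phi) = [ffun v => oapp f 0 (insub v)].
Proof.
have phiE : finfun phi = phi :> (V -> R) by apply/funext => v; rewrite ffunE.
split=> [[eq_in eq_out] | /ffunP Dphi].
- apply/ffunP => v; rewrite !ffunE phiE; case: insubP => [w vO <- | vO].
    by rewrite (valP w) eq_in.
  by rewrite (negPf vO) eq_out ?inE.
- split=> [w | v]; last rewrite inE => vO.
    by have := Dphi (val w); rewrite !ffunE phiE (valP w) valK.
  by have := Dphi v; rewrite !ffunE (negPf vO) insubN.
Qed.

End Dirichlet.

Theorem theorem4p1 (R : realType) (V : finType) (H : hypergraph V)
    (mu : V -> R) (omega : {set V} -> R) (Omega : {set V})
    (Hconn : hconnected H)
    (mu_gt0 : forall v : V, 0 < mu v)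
    (omega_gt0 : forall e : {set V}, e \in hyperedges H -> 0 < omega e)
    (Omega_neq0 : Omega != set0)
    (OmegaC_neq0 : ~: Omega != set0)
    (f : {v : V | v \in Omega} -> R) :
  exists! phi : V -> R, dirichlet_solution H mu omega f phi.
Proof.
have Dbij := @dirichlet_operator_bij R V H mu omega mu_gt0 omega_gt0 Omega
               Hconn OmegaC_neq0.
have [D' _ D'K] := Dbij.
set g : {ffun V -> R^o} := [ffun v => oapp f 0 (insub v)].
exists (D' g); split=> [|psi /dirichlet_solutionP Dpsi].
- by apply/dirichlet_solutionP; rewrite ffunK D'K.
- apply/funext => v; rewrite -[psi v]ffunE; congr (fun_of_fin _ v).
  by apply: (bij_inj Dbij); rewrite D'K Dpsi.
Qed.
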